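(* Let $d\in\mathbb{N}$, $N\in2\mathbb{N}$, and let the kernel $K_N(\boldsymbol{x})=\sum_{\boldsymbol{k}\in I_N}\hat w_{\boldsymbol{k}}e^{2\pi i\boldsymbol{k}\cdot\boldsymbol{x}}$, with weights $\hat w_{\boldsymbol{k}}>0$ and $\sum_{\boldsymbol{k}\in I_N}\hat w_{\boldsymbol{k}}=1$, satisfy for some $\beta>d$, some constant $C_\beta$, and all $\boldsymbol{x}\in[-\frac12,\frac12]^d\setminus\{\boldsymbol{0}\}$ the localisation property $$|K_N(\boldsymbol{x})|\le\frac{C_\beta}{N^\beta\|\boldsymbol{x}\|_\infty^\beta}.$$ Let $\mathcal{X}=\{\boldsymbol{x}_0,\dots,\boldsymbol{x}_{M-1}\}\subset\mathbb{T}^d$ be a sampling set of arbitrary nodes with separation distance $0<q\le\frac12$. Then the smallest eigenvalue $\lambda$ and the largest eigenvalue $\Lambda$ of the kernel matrix $\boldsymbol{K}_N=(K_N(\boldsymbol{x}_j-\boldsymbol{x}_l))_{j,l=0,\dots,M-1}$ satisfy $$1-\frac{2^d(2^d-1)\,\zeta(\beta-d+1)\,C_\beta}{N^\beta q^\beta}\le\lambda\le1\le\Lambda\le1+\frac{2^d(2^d-1)\,\zeta(\beta-d+1)\,C_\beta}{N^\beta q^\beta}.$$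
   Context: $\mathbb{T}=[-\frac12,\frac12)$ is the torus (reals modulo 1), $I_N=\{-\frac N2,\dots,\frac N2-1\}^d$, and $\operatorname{dist}(\boldsymbol{x},\boldsymbol{y})=\min_{\boldsymbol{j}\in\mathbb{Z}^d}\|\boldsymbol{x}+\boldsymbol{j}-\boldsymbol{y}\|_\infty$. The separation distance of $\mathcal{X}$ is $q=\min_{j\ne l}\operatorname{dist}(\boldsymbol{x}_j,\boldsymbol{x}_l)$. $\zeta(s)=\sum_{r=1}^\infty r^{-s}$ for $s>1$. The matrix $\boldsymbol{K}_N$ is Hermitian, so its eigenvalues are real. *)

(* Defs.v *)
From HB Require Import structures.
From mathcomp Require Import all_boot all_order all_algebra.
From mathcomp Require Import all_classical all_reals all_analysis.
From mathcomp Require Import complex.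

Set Implicit Arguments.
Unset Strict Implicit.
Unset Printing Implicit Defensive.
Import Order.TTheory GRing.Theory Num.Theory.
Import numFieldNormedType.Exports.
Local Open Scope classical_set_scope.
Local Open Scope ring_scope.
Local Open Scope complex_scope.

(* The Riemann zeta function for real s > 1, as the limit of the partial sums
   of 1^(-s) + 2^(-s) + ... *)
Definition zeta (R : realType) (s : R) : R :=
  limn (series (fun n : nat => n.+1%:R `^ (- s))).

Definition cis (R : realType) (t : R) : R[i] := cos t +i* sin t.

(* Intended for N even and positive. *)
Definition freqs (d N : nat) : set 'rV[int]_d :=
  [set k | forall i, (- (N./2)%:Z <= k 0 i) && (k 0 i <= (N./2)%:Z - 1)].
Arguments freqs : clear implicits.

(* The sum over [freqs d N] in [kernel_fun] is the sum of the library for sets,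
   which is only meaningful because this set is finite. *)
Lemma finite_freqs (d N : nat) : finite_set (freqs d N).
Proof.
pose f (u : {ffun 'I_d -> 'I_(N./2 + N./2)}) : 'rV[int]_d :=
  \row_i ((u i)%:Z - (N./2)%:Z).
apply: (@sub_finite_set _ _ (f @` setT)); last exact/finite_image/finite_finset.
move=> k hk.
have hb i : (absz (k ord0 i + (N./2)%:Z)%R < N./2 + N./2)%N.
  case/andP: (hk i) => h1 h2; rewrite -ltz_nat gez0_abs; last first.
    by rewrite -(opprK (N./2)%:Z) subr_ge0.
  by rewrite PoszD ltrD2r -lezD1 -lerBrDr.
exists [ffun i => Ordinal (hb i)] => //.
apply/rowP => i; rewrite !mxE ffunE /= gez0_abs ?addrK//.
case/andP: (hk i) => h1 _.
by rewrite -(opprK (N./2)%:Z) subr_ge0.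
Qed.

Definition dotp (R : realType) (d : nat) (k : 'rV[int]_d) (x : 'rV[R]_d) : R :=
  \sum_(i < d) (k 0 i)%:~R * x 0 i.

(* Being 1-periodic in every coordinate, the kernel on the torus is given by
   a function on R^d. *)
Definition kernel_fun (R : realType) (d N : nat) (w : 'rV[int]_d -> R)
    (x : 'rV[R]_d) : R[i] :=
  \sum_(k \in freqs d N) (w k)%:C * cis (2 * pi * dotp k x).

(* The norm of the library on 'rV[R]_d is the maximum norm. *)
Definition tdist (R : realType) (d : nat) (x y : 'rV[R]_d) : R :=
  inf [set `|x + map_mx intr j - y| | j in [set: 'rV[int]_d]].

(* As inf set0 = 0, a positive separation distance entails that there are at
   least two nodes and that they are pairwise distinct. *)
Definition sepdist (R : realType) (d M : nat) (x : 'I_M -> 'rV[R]_d) : R :=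
  inf [set tdist (x p.1) (x p.2) | p in [set p : 'I_M * 'I_M | p.1 != p.2]].

Definition kernel_mx (R : realType) (d N M : nat) (w : 'rV[int]_d -> R)
    (x : 'I_M -> 'rV[R]_d) : 'M[R[i]]_M :=
  \matrix_(j, l) kernel_fun N w (x j - x l).

(* For matrices with real spectrum only, such as Hermitian ones. *)
Definition smallest_eigenvalue (R : realType) (M : nat) (A : 'M[R[i]]_M)
    (a : R) : Prop :=
  eigenvalue A a%:C /\ forall b : R, eigenvalue A b%:C -> a <= b.

Definition largest_eigenvalue (R : realType) (M : nat) (A : 'M[R[i]]_M)
    (a : R) : Prop :=
  eigenvalue A a%:C /\ forall b : R, eigenvalue A b%:C -> b <= a.

(* Main.v *)
Require Import Defs.
From HB Require Import structures.
From mathcomp Require Import all_boot all_order all_algebra.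
From mathcomp Require Import all_classical all_reals all_analysis.
From mathcomp Require Import complex.
From mathcomp Require Import ring lra zify.

Set Implicit Arguments.
Unset Strict Implicit.
Unset Printing Implicit Defensive.
Import Order.TTheory GRing.Theory Num.Theory.
Import numFieldNormedType.Exports.
Local Open Scope classical_set_scope.
Local Open Scope ring_scope.
Local Open Scope complex_scope.

(** The diagonal entries of the kernel matrix are K(0) = 1, since the weights
    sum to 1. Hence its trace is the number of nodes, the mean of its (real)
    eigenvalues is 1, and 1 lies between the smallest and the largest of them
    (extreme_eigenvalues_mean).

    For the quantitative bounds, Gershgorin's theorem (gershgorin) places every
    eigenvalue within the sum of |K(x_l - x_j)| over l <> j from 1, for some
    column j. The kernel being 1-periodic, each x_l - x_j may be replaced by a
    representative y_l in the cube [-1/2, 1/2]^d. The y_l have norm at least q,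
    and their mutual distances are at least q as well, because these are also
    distances between translates of nodes.

    The localisation property reduces the sum to one over |y_l|^(-beta), which
    a packing argument controls (sum_separated_powR_le). Cut space into
    half-open cubes of side q, symmetrically with respect to the coordinate
    hyperplanes; each of them contains at most one y_l. The shell
    r q <= |y| < (r + 1) q consists of (2 (r + 1))^d - (2 r)^d cubes, at most
    2^d (2^d - 1) r^(d - 1) (cell_count_le), and each of its points contributes
    at most (r q)^(-beta). Summing over r >= 1 gives a partial sum of
    zeta(beta - d + 1), multiplied by 2^d (2^d - 1) q^(-beta). *)

(** * Partial sums of the zeta function *)

(** As [zeta] is defined by a limit, the point is that the series converges.
    Write S n for the sum of the first n terms. Pairing the terms of index
    2k and 2k + 1 gives S (2n + 1) <= 1 + 2^(1 - s) S n; since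
    S n <= S (2n + 1) and 2^(1 - s) < 1, the partial sums are bounded. *)
Lemma zeta_partial_sum_le (R : realType) (s : R) (n : nat) :
  1 < s -> \sum_(k < n) k.+1%:R `^ (- s) <= zeta s.
Proof.
move=> s_gt1; pose u (k : nat) : R := k.+1%:R `^ (- s).
have u_ge0 k : 0 <= u k by exact: powR_ge0.
have u_noninc k : u k.+1 <= u k.
  rewrite /u !powRN lef_pV2 ?posrE ?powR_gt0 ?ltr0n //.
  by apply: ge0_ler_powR; rewrite ?nnegrE ?ler0n ?ler_nat //; lra.
have S_mono : {homo series u : m k / (m <= k)%N >-> m <= k}.
  by apply/nondecreasing_series => k _ _; exact: u_ge0.
pose c : R := 2 * 2 `^ (- s).
have c_lt1 : c < 1.
  have -> : c = 2 `^ (1 - s) by rewrite powRD ?powRr1 //; lra.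
  rewrite -opprB powRN invf_lt1 ?powR_gt0 //.
  have : 1 `^ (s - 1) < 2 `^ (s - 1) :> R.
    by apply: gt0_ltr_powR; rewrite ?nnegrE //; lra.
  by rewrite powR1.
have c_ge0 : 0 <= c by rewrite mulr_ge0 ?powR_ge0.
have u_odd k : u k.*2.+1 = 2 `^ (- s) * u k.
  by rewrite /u -doubleS -muln2 mulnC natrM powRM ?ler0n.
have S_double k : series u k.*2.+1 <= 1 + c * series u k.
  elim: k => [|k IHk].
    by rewrite /series /= big_nat1 big_geq // /u powR1 mulr0 addr0.
  rewrite doubleS 2!(seriesSr _ _.+1) (seriesSr _ k) mulrDr /=.
  have := u_noninc k.*2.+1; rewrite u_odd /c; move: IHk; rewrite /c.
  lra.
have S_bound k : series u k <= (1 - c)^-1.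
  have : series u k <= series u k.*2.+1.
    by apply: S_mono; rewrite -addnn -addnS leq_addr.
  move=> /le_trans /(_ (S_double k)).
  rewrite -[_^-1]mul1r ler_pdivlMr ?subr_gt0 // => ?; lra.
have -> : \sum_(k < n) k.+1%:R `^ (- s) = series u n.
  by rewrite /series /= big_mkord.
apply: nondecreasing_cvgn_le => //.
apply: nondecreasing_is_cvgn => //.
by exists (1 - c)^-1 => _ [k _ <-].
Qed.

(** * Packing separated points into cubic cells *)

(** In the binomial expansion of the left-hand side, the powers of r below the
    highest one are at most r ^ d, and their coefficients add up to
    2 ^ (d + 1) - 1. *)
Lemma succ_exp_le (d r : nat) : (0 < r)%N ->
  (r.+1 ^ d.+1 <= r ^ d.+1 + (2 ^ d.+1 - 1) * r ^ d)%N.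
Proof.
move=> r_gt0; elim: d => [|d IHd]; first by rewrite !expn1 expn0 muln1 addn1.
rewrite (expnS r.+1); apply: (leq_trans (leq_mul (leqnn r.+1) IHd)).
(* The recursion 2 (2 ^ d - 1) + 1 = 2 ^ (d + 1) - 1 closes the induction. *)
have e2 : (2 ^ d.+2 - 1 = 2 * (2 ^ d.+1 - 1) + 1)%N.
  by rewrite (expnS 2 d.+1); have := expn_gt0 2 d.+1; lia.
rewrite e2 (expnS r d.+1) (expnS r d); move: (2 ^ d.+1 - 1)%N => a.
have : (a * r ^ d <= a * (r * r ^ d))%N by rewrite leq_mul2l leq_pmull ?orbT.
nia.
Qed.

Lemma cell_count_le (d r : nat) : (0 < r)%N ->
  ((2 * r.+1) ^ d.+1 - (2 * r) ^ d.+1 <= 2 ^ d.+1 * (2 ^ d.+1 - 1) * r ^ d)%N.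
Proof.
move=> r_gt0; rewrite !expnMn -mulnBr -mulnA leq_mul2l leq_subLR.
by rewrite succ_exp_le // orbT.
Qed.

Lemma entry_le_norm (R : realType) (d : nat) (x : 'rV[R]_d) (i : 'I_d) :
  `|x 0 i| <= `|x|.
Proof.
rewrite -[`|x|]/(mx_norm x) mx_normrE.
exact: (@le_bigmax _ _ _ 0 (fun ij : 'I_1 * 'I_d => `|x ij.1 ij.2|) (0, i)).
Qed.

Lemma norm_attained (R : realType) (d : nat) (x : 'rV[R]_d) :
  0 < `|x| -> exists i, `|x| = `|x 0 i|.
Proof.
rewrite -[`|x|]/(mx_norm x) => /lt0r_neq0 /mx_norm_neq0 [[a i] ->].
by exists i; rewrite (ord1 a).
Qed.

(** The cells of the line are indexed by a sign and by n, the truncation of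
    |a| / q: they are [n q, (n + 1) q) and its mirror image. Unlike the cells
    cut out by floor (a / q), they are mirror images of each other, so that
    the number n tells in which shell around the origin a point lies, even
    when it lies on the boundary of a cell. *)
Lemma dist_lt_same_cell (R : realType) (a b q : R) : 0 < q ->
  (a < 0) = (b < 0) -> Num.truncn (`|a| / q) = Num.truncn (`|b| / q) ->
  `|a - b| < q.
Proof.
move=> q_gt0 sgn_ab trunc_ab.
have cell (t : R) : let n := (Num.truncn (`|t| / q))%:R in
    n * q <= `|t| < n * q + q.
  have /truncn_itv : 0 <= `|t| / q by exact: divr_ge0 (normr_ge0 t) (ltW q_gt0).
  by rewrite ler_pdivlMr // ltr_pdivrMr // -natr1 mulrDl mul1r.
have := cell a; have := cell b; rewrite -trunc_ab /=.
move: (_ * q) => m /andP[b1 b2] /andP[a1 a2]; rewrite ltr_norml.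
move: a1 a2 b1 b2.
case: (ltP a 0) sgn_ab => [a_lt0 /esym b_lt0|a_ge0 /esym/negbT].
  rewrite (ltr0_norm a_lt0) (ltr0_norm b_lt0) => *; lra.
rewrite -leNgt => b_ge0; rewrite (ger0_norm a_ge0) (ger0_norm b_ge0) => *; lra.
Qed.

(** Sending a point to the cell that contains it is injective by separation. A
    cell is given by a sign and a number for each coordinate, and the cells
    that are reached have r as the largest of these numbers: they are counted
    as all cells with numbers at most r, minus those with numbers below r. *)
Lemma card_shell_le (R : realType) (d : nat) (I : finType) (P : pred I)
    (y : I -> 'rV[R]_d) (q : R) (r : nat) :
  0 < q -> (0 < r)%N ->
  (forall l l', P l -> P l' -> l != l' -> q <= `|y l - y l'|) ->
  (#|[pred l | P l && (Num.truncn (`|y l| / q) == r)]|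
     <= (2 * r.+1) ^ d - (2 * r) ^ d)%N.
Proof.
move=> q_gt0 r_gt0 sep; set S := [pred l | _].
pose n l i := Num.truncn (`|y l 0 i| / q).
have nr l : l \in S -> (forall i, (n l i <= r)%N) /\ exists i, n l i = r.
  rewrite inE => /andP[_ /eqP def_r]; split=> [i|].
    by rewrite -def_r le_truncn // ler_pM2r ?invr_gt0 // entry_le_norm.
  have /norm_attained [i yi] : 0 < `|y l|.
    rewrite lt_def normr_ge0 andbT; apply/eqP => y0.
    by move: r_gt0; rewrite -def_r y0 mul0r truncn0.
  by exists i; rewrite /n -yi.
pose f l := [ffun i => (y l 0 i < 0, inord (n l i) : 'I_r.+1)].
(* The cells that are strictly closer to the origin than the shell. *)
pose B := [set g : {ffun 'I_d -> bool * 'I_r.+1} |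
  g \in ffun_on [pred p : bool * 'I_r.+1 | (p.2 < r)%N]]%SET.
have inner_card : #|[pred p : bool * 'I_r.+1 | (p.2 < r)%N]| = (2 * r)%N.
  rewrite (eq_card (_ : _ =i [predX predT & [pred k : 'I_r.+1 | (k < r)%N]])).
    rewrite cardX card_bool -sum1_card (big_ord_narrow (leqnSn r)) sum1_card.
    by rewrite card_ord.
  by case.
have -> : ((2 * r.+1) ^ d - (2 * r) ^ d)%N = #|(~: B)%SET|.
  by rewrite cardsCs finset.setCK card_ffun card_prod card_bool !card_ord cardsE
             card_ffun_on inner_card card_ord.
rewrite -(@card_in_imset _ _ f S).
  apply: subset_leq_card; apply/fintype.subsetP => _ /imsetP[l lS ->].
  have [n_le [i ni]] := nr l lS.
  rewrite !inE; apply/negP => /ffun_onP /(_ i).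
  by rewrite ffunE inE /= inordK ?ltnS ?n_le // ni ltnn.
move=> l l' lS l'S /ffunP f_eq; apply/eqP/negPn/negP => neq_ll'.
have [/andP[Pl _] /andP[Pl' _]] := (lS, l'S).
have := sep l l' Pl Pl' neq_ll'; apply/negP; rewrite -ltNge.
have [/le_lt_trans-> //|/norm_attained[i ->]] := leP `|y l - y l'| 0.
have [[n_le _] [n'_le _]] := (nr l lS, nr l' l'S).
rewrite !mxE; apply: dist_lt_same_cell => //.
  by have := f_eq i; rewrite !ffunE => -[].
have := f_eq i; rewrite !ffunE => -[_ /(congr1 (@nat_of_ord _))].
by rewrite !inordK ?ltnS.
Qed.

(** Grouping the points by shell, the r-th shell contributes at most
    2^d (2^d - 1) r^(d - 1) (r q)^(-beta), which is a term of the series of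
    zeta(beta - d + 1). The innermost shell that occurs is r = 1, as no point
    is closer than q to the origin. *)
Lemma sum_separated_powR_le (R : realType) (d : nat) (I : finType)
    (P : pred I) (y : I -> 'rV[R]_d) (q beta : R) :
  (0 < d)%N -> d%:R < beta -> 0 < q ->
  (forall l, P l -> q <= `|y l|) ->
  (forall l l', P l -> P l' -> l != l' -> q <= `|y l - y l'|) ->
  \sum_(l | P l) `|y l| `^ (- beta) <=
    2 ^+ d * (2 ^+ d - 1) * zeta (beta - d%:R + 1) * q `^ (- beta).
Proof.
case: d y => // d y _ d_lt_beta q_gt0 y_ge_q sep.
have beta_gt0 : 0 < beta by apply: le_lt_trans d_lt_beta.
(* The series starts at 1^(-s): shell r corresponds to its term r - 1. *)
pose t l := (Num.truncn (`|y l| / q)).-1.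
have def_t l : P l -> Num.truncn (`|y l| / q) = (t l).+1.
  by move=> Pl; rewrite prednK // truncn_gt0 ler_pdivlMr ?mul1r ?y_ge_q.
pose m := (\max_l t l).+1.
have t_lt l : (t l < m)%N by rewrite ltnS leq_bigmax.
pose K : R := 2 ^+ d.+1 * (2 ^+ d.+1 - 1).
have K_ge0 : 0 <= K.
  by rewrite mulr_ge0 ?exprn_ge0 // subr_ge0 exprn_ege1 // ler1n.
pose s := beta - d.+1%:R + 1.
have shell (k : 'I_m) :
    \sum_(l | P l && (Ordinal (t_lt l) == k)) `|y l| `^ (- beta) <=
      K * k.+1%:R `^ (- s) * q `^ (- beta).
  have term l : P l && (Ordinal (t_lt l) == k) ->
      `|y l| `^ (- beta) <= k.+1%:R `^ (- beta) * q `^ (- beta).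
    case/andP=> Pl /eqP <- /=.
    have le_y : (t l).+1%:R * q <= `|y l|.
      have /truncn_itv : 0 <= `|y l| / q.
        exact: divr_ge0 (normr_ge0 _) (ltW q_gt0).
      by rewrite def_t // ler_pdivlMr // => /andP[].
    rewrite -powRM ?ler0n ?(ltW q_gt0) // !powRN.
    have tq_gt0 : 0 < (t l).+1%:R * q by rewrite mulr_gt0 ?ltr0n.
    rewrite lef_pV2 ?posrE ?powR_gt0 ?(lt_le_trans tq_gt0) //.
    apply: (ge0_ler_powR (ltW beta_gt0)) => //; rewrite nnegrE ?normr_ge0 //.
    exact: ltW.
  apply: (le_trans (ler_sum _ term)).
  rewrite sumr_const -[leLHS]mulr_natl mulrA ler_wpM2r ?powR_ge0 //.
  have -> : k.+1%:R `^ (- s) = k.+1%:R ^+ d * k.+1%:R `^ (- beta) :> R.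
    rewrite -powR_mulrn ?ler0n // -powRD; last by rewrite pnatr_eq0 implybT.
    by congr (_ `^ _); rewrite /s -natr1; ring.
  rewrite mulrA ler_wpM2r ?powR_ge0 //.
  have -> : K * k.+1%:R ^+ d = (2 ^ d.+1 * (2 ^ d.+1 - 1) * k.+1 ^ d)%:R.
    by rewrite !natrM natrB ?expn_gt0 // !natrX.
  rewrite ler_nat; apply: leq_trans (cell_count_le d (ltn0Sn k)).
  apply: leq_trans (card_shell_le q_gt0 (ltn0Sn k) sep).
  apply/eq_leq/eq_card => l; rewrite unfold_in inE.
  by have [/def_t ->|] := boolP (P l).
rewrite (partition_big (fun l => Ordinal (t_lt l)) predT) //=.
apply: (le_trans (ler_sum _ (fun k _ => shell k))).
rewrite -mulr_suml -mulr_sumr ler_wpM2r ?powR_ge0 // ler_wpM2l //.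
by apply: zeta_partial_sum_le; rewrite /s ltrDr subr_gt0.
Qed.

(** * The kernel and its matrix *)

Lemma cisN (R : realType) (t : R) : cis (- t) = Num.conj (cis t).
Proof. by rewrite /cis cosN sinN. Qed.

Lemma cisD2pi_int (R : realType) (t : R) (m : int) :
  cis (t + 2 * pi * m%:~R) = cis t.
Proof.
have cis_nat (u : R) (n : nat) : cis (u + 2 * pi * n%:R) = cis u.
  rewrite mulr_natr [2 * pi]mulr_natl.
  by rewrite /cis (periodicn (@cosD2pi R)) (periodicn (@sinD2pi R)).
case: m => n; first exact: cis_nat.
by rewrite NegzE mulrNz mulrN -[LHS](cis_nat _ n.+1) subrK.
Qed.

Lemma dotp_int (R : realType) (d : nat) (k m : 'rV[int]_d) :
  dotp k (map_mx intr m) = (\sum_(i < d) k 0 i * m 0 i)%:~R :> R.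
Proof. by rewrite rmorph_sum; apply: eq_bigr => i _; rewrite !mxE rmorphM. Qed.

Lemma dotpD (R : realType) (d : nat) (k : 'rV[int]_d) (x y : 'rV[R]_d) :
  dotp k (x + y) = dotp k x + dotp k y.
Proof. by rewrite -big_split; apply: eq_bigr => i _; rewrite mxE mulrDr. Qed.

Lemma dotpN (R : realType) (d : nat) (k : 'rV[int]_d) (x : 'rV[R]_d) :
  dotp k (- x) = - dotp k x.
Proof. by rewrite -sumrN; apply: eq_bigr => i _; rewrite mxE mulrN. Qed.

Lemma kernel_fun_periodic (R : realType) (d N : nat) (w : 'rV[int]_d -> R)
    (x : 'rV[R]_d) (m : 'rV[int]_d) :
  kernel_fun N w (x + map_mx intr m) = kernel_fun N w x.
Proof.
apply: eq_fsbigr => k _.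
by rewrite dotpD dotp_int mulrDr cisD2pi_int.
Qed.

Lemma kernel_funN (R : realType) (d N : nat) (w : 'rV[int]_d -> R)
    (x : 'rV[R]_d) :
  kernel_fun N w (- x) = Num.conj (kernel_fun N w x).
Proof.
rewrite /kernel_fun !fsbig_finite ?rmorph_sum; try exact: finite_freqs.
apply: eq_bigr => k _.
by rewrite dotpN mulrN cisN rmorphM; congr (_ * _); exact: esym (conjc_real _).
Qed.

Lemma kernel_fun0 (R : realType) (d N : nat) (w : 'rV[int]_d -> R) :
  kernel_fun N w 0 = (\sum_(k \in freqs d N) w k)%:C.
Proof.
rewrite /kernel_fun !fsbig_finite ?rmorph_sum; try exact: finite_freqs.
apply: eq_bigr => k _.
have -> : dotp k 0 = 0 :> R.
  by rewrite /dotp big1 // => i _; rewrite mxE mulr0.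
by rewrite mulr0 /cis cos0 sin0 mulr1.
Qed.

Lemma kernel_mx_hermitian (R : realType) (d N M : nat) (w : 'rV[int]_d -> R)
    (x : 'I_M -> 'rV[R]_d) :
  kernel_mx N w x \is hermsymmx.
Proof.
apply/is_hermitianmxP; rewrite expr0 scale1r; apply/matrixP => j l.
by rewrite !mxE -kernel_funN opprB.
Qed.

Lemma kernel_mx_diag (R : realType) (d N M : nat) (w : 'rV[int]_d -> R)
    (x : 'I_M -> 'rV[R]_d) (j : 'I_M) :
  \sum_(k \in freqs d N) w k = 1 -> kernel_mx N w x j j = 1.
Proof. by move=> w1; rewrite mxE subrr kernel_fun0 w1. Qed.

(** * Eigenvalues of Hermitian matrices *)

(** Compare the j-th coordinates in v A = a v, where j is the index of an entry
    of v with the largest modulus. *)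
Lemma gershgorin (R : rcfType) (n : nat) (A : 'M[R[i]]_n) (a : R[i]) :
  eigenvalue A a ->
  exists j, `|a - A j j| <= \sum_(l | l != j) `|A l j|.
Proof.
case/eigenvalueP => v vA v_neq0.
have [i0 v_i0] : exists i, v 0 i != 0 by apply/rV0Pn.
(* The order on R[i] is partial: the maximum is taken over real parts. *)
pose nv i : R := complex.Re `|v 0 i|.
have nvE i : `|v 0 i| = (nv i)%:C by rewrite RRe_real ?normr_real.
have [j _ j_max] := @arg_maxP _ _ _ i0 predT nv isT.
have v_le l : `|v 0 l| <= `|v 0 j| by rewrite !nvE lecR; apply: j_max.
have vj_gt0 : 0 < `|v 0 j| by rewrite (lt_le_trans _ (v_le i0)) ?normr_gt0.
exists j; rewrite -(ler_pM2r vj_gt0) -normrM.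
have -> : (a - A j j) * v 0 j = \sum_(l | l != j) v 0 l * A l j.
  have /matrixP /(_ 0 j) := vA; rewrite !mxE (bigD1 j) //= => eq_av.
  by rewrite mulrBl -eq_av [X in _ - X]mulrC addrAC subrr add0r.
apply: le_trans (ler_norm_sum _ _ _) _; rewrite mulr_suml.
by apply: ler_sum => l _; rewrite normrM mulrC ler_wpM2l.
Qed.

(** Spectral theorem: D is the spectrum, with multiplicities. *)
Lemma hermitian_trace (R : rcfType) (n : nat) (A : 'M[R[i]]_n) :
  A \is hermsymmx ->
  exists D : 'I_n -> R,
    (forall i, eigenvalue A (D i)%:C) /\ \tr A = (\sum_i D i)%:C.
Proof.
move=> A_herm.
have /orthomx_spectralP A_diag := hermitian_normalmx A_herm.
have /mxOverP D_real := hermitian_spectral_diag_real A_herm.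
have P_unit := spectral_unit A.
pose D i : R := complex.Re (spectral_diag A 0 i).
have DE i : (D i)%:C = spectral_diag A 0 i by rewrite RRe_real.
exists D; split=> [i|].
  apply/eigenvalueP; exists (row i (spectralmx A)).
    rewrite -row_mul {2}A_diag !mulmxA mulmxV // mul1mx row_mul.
    by rewrite row_diag_mx -scalemxAl -rowE DE.
  apply/eqP => row0; have := row_free_unit (spectralmx A).
  rewrite P_unit => /row_freeP [B PB].
  have := congr1 (mulmx^~ B) row0; rewrite /= -row_mul PB mul0mx.
  by move/matrixP/(_ 0 i); rewrite !mxE eqxx => /eqP; rewrite oner_eq0.
rewrite {1}A_diag mxtrace_mulC mulmxA mulmxV // mul1mx mxtrace_diag rmorph_sum.
by apply: eq_bigr => i _; rewrite -DE.
Qed.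

(** The trace is n, so the eigenvalues have mean 1. *)
Lemma extreme_eigenvalues_mean (R : realType) (n : nat) (A : 'M[R[i]]_n)
    (a b : R) :
  A \is hermsymmx -> (forall i, A i i = 1) ->
  smallest_eigenvalue A a -> largest_eigenvalue A b -> a <= 1 <= b.
Proof.
move=> A_herm A_diag [a_eig a_min] [_ b_max].
have [D [D_eig tr_D]] := hermitian_trace A_herm.
have n_gt0 : (0 < n)%N.
  have [v _ v_neq0] := eigenvalueP a_eig.
  by have /rV0Pn [[i i_lt] _] := v_neq0; apply: leq_trans i_lt.
have sumD : \sum_i D i = n%:R.
  apply: complexI; rewrite -tr_D /mxtrace (eq_bigr _ (fun i _ => A_diag i)).
  by rewrite sumr_const card_ord rmorph_nat.
have n_gt0' : 0 < n%:R :> R by rewrite ltr0n.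
have const_sum (c : R) : \sum_(i < n) c = n%:R * c.
  by rewrite sumr_const card_ord mulr_natl.
apply/andP; split; rewrite -(ler_pM2l n_gt0') mulr1 -const_sum -sumD.
  by apply: ler_sum => i _; exact: a_min (D_eig i).
by apply: ler_sum => i _; exact: b_max (D_eig i).
Qed.

(** * Nodes on the torus *)

Lemma sepdist_le (R : realType) (d M : nat) (x : 'I_M -> 'rV[R]_d)
    (j l : 'I_M) (m : 'rV[int]_d) :
  j != l -> sepdist x <= `|x j + map_mx intr m - x l|.
Proof.
have tdist_lb (a b : 'rV[R]_d) :
    lbound [set `|a + map_mx intr k - b| | k in [set: 'rV[int]_d]] 0.
  by move=> _ [k _ <-].
move=> neq_jl; apply: (@le_trans _ _ (tdist (x j) (x l))); apply: ge_inf.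
- exists 0 => _ [p _ <-]; apply: lb_le_inf; last exact: tdist_lb.
  by exists `|x p.1 + map_mx intr 0 - x p.2|; exists 0.
- by exists (j, l).
- by exists 0; apply: tdist_lb.
- by exists m.
Qed.

Lemma torus_representative (R : realType) (d : nat) (x : 'rV[R]_d) :
  exists m : 'rV[int]_d,
    forall i, - 2^-1 <= (x + map_mx intr m) 0 i <= 2^-1.
Proof.
exists (\row_i - Num.floor (x 0 i + 2^-1)) => i; rewrite !mxE rmorphN /=.
have := floor_itv (x 0 i + 2^-1); rewrite intrD => /andP[le_x lt_x].
by apply/andP; split; move: le_x lt_x; move: (_%:~R) => ? *; lra.
Qed.

(** Evaluate the localisation property at the corner (1/2, ..., 1/2), which is
    nonzero because d > 0. *)
Lemma localisation_constant_ge0 (R : realType) (d N : nat)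
    (w : 'rV[int]_d -> R) (beta C : R) :
  (0 < d)%N -> (0 < N)%N ->
  (forall y : 'rV[R]_d, (forall i, - 2^-1 <= y 0 i <= 2^-1) -> y != 0 ->
     `|kernel_fun N w y| <= (C / (N%:R `^ beta * `|y| `^ beta))%:C) ->
  0 <= C.
Proof.
move=> d_gt0 N_gt0 /(_ (const_mx 2^-1)) K_le.
have y_neq0 : const_mx 2^-1 != 0 :> 'rV[R]_d.
  by apply/rV0Pn; exists (Ordinal d_gt0); rewrite mxE invr_eq0 pnatr_eq0.
have y_box i : - 2^-1 <= (const_mx 2^-1 : 'rV[R]_d) 0 i <= 2^-1.
  by rewrite mxE; apply/andP; split; lra.
have := le_trans (normr_ge0 _) (K_le y_box y_neq0).
by rewrite ler0c pmulr_lge0 // invr_gt0 mulr_gt0 ?powR_gt0 ?ltr0n ?normr_gt0.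
Qed.

(** The representatives y_l of x_l - x_j inherit from the nodes the separation
    from 0 and from each other; then the packing bound applies to them. *)
Lemma kernel_mx_offdiag_sum_le (R : realType) (d N M : nat)
    (w : 'rV[int]_d -> R) (beta C : R) (x : 'I_M -> 'rV[R]_d) (j : 'I_M) :
  (0 < d)%N -> (0 < N)%N -> d%:R < beta ->
  (forall y : 'rV[R]_d, (forall i, - 2^-1 <= y 0 i <= 2^-1) -> y != 0 ->
     `|kernel_fun N w y| <= (C / (N%:R `^ beta * `|y| `^ beta))%:C) ->
  0 < sepdist x ->
  \sum_(l | l != j) `|kernel_mx N w x l j| <=
    (2 ^+ d * (2 ^+ d - 1) * zeta (beta - d%:R + 1) * C
       / (N%:R `^ beta * sepdist x `^ beta))%:C.
Proof.
move=> d_gt0 N_gt0 d_lt_beta K_le q_gt0; set q := sepdist x in q_gt0 *.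
have C_ge0 := localisation_constant_ge0 d_gt0 N_gt0 K_le.
have [m y_box] := boolp.choice (fun l => torus_representative (x l - x j)).
pose y l := x l - x j + map_mx intr (m l).
have y_ge_q l : l != j -> q <= `|y l|.
  by rewrite /y addrAC; apply: sepdist_le.
have y_sep l l' : l != j -> l' != j -> l != l' -> q <= `|y l - y l'|.
  move=> _ _ neq_ll'; have := sepdist_le x (m l - m l') neq_ll'.
  suff -> : x l + map_mx intr (m l - m l') - x l' = y l - y l' by [].
  by apply/rowP => i; rewrite !mxE rmorphB /=; ring.
have K_y l : l != j ->
    `|kernel_mx N w x l j| <= (C / N%:R `^ beta * `|y l| `^ (- beta))%:C.
  move=> neq_lj; have y_neq0 : y l != 0.
    by rewrite -normr_gt0 (lt_le_trans q_gt0) ?y_ge_q.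
  have := K_le (y l) (y_box l) y_neq0.
  by rewrite powRN -mulrA -invfM mxE kernel_fun_periodic.
apply: (le_trans (ler_sum _ K_y)); rewrite -rmorph_sum lecR -mulr_sumr.
have sum_le := sum_separated_powR_le d_gt0 d_lt_beta q_gt0 y_ge_q y_sep.
have CN_ge0 : 0 <= C / N%:R `^ beta by rewrite divr_ge0 ?powR_ge0.
apply: le_trans (ler_wpM2l CN_ge0 sum_le) _.
by rewrite powRN invfM le_eqVlt; apply/orP; left; apply/eqP; ring.
Qed.

Theorem theorem4p6 (R : realType) (d N M : nat) (w : 'rV[int]_d -> R)
    (beta C : R) (x : 'I_M -> 'rV[R]_d) (lambda Lambda : R) :
  (0 < d)%N ->
  (0 < N)%N -> ~~ odd N ->
  (forall k, freqs d N k -> 0 < w k) ->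
  \sum_(k \in freqs d N) w k = 1 ->
  d%:R < beta ->
  (forall y : 'rV[R]_d, (forall i, - 2^-1 <= y 0 i <= 2^-1) -> y != 0 ->
     `|kernel_fun N w y| <= (C / (N%:R `^ beta * `|y| `^ beta))%:C) ->
  (forall j i, - 2^-1 <= x j 0 i < 2^-1) ->
  let q := sepdist x in
  0 < q -> q <= 2^-1 ->
  smallest_eigenvalue (kernel_mx N w x) lambda ->
  largest_eigenvalue (kernel_mx N w x) Lambda ->
  let B := 2 ^+ d * (2 ^+ d - 1) * zeta (beta - d%:R + 1) * C
           / (N%:R `^ beta * q `^ beta) in
  [/\ 1 - B <= lambda, lambda <= 1, 1 <= Lambda & Lambda <= 1 + B].
Proof.
move=> d_gt0 N_gt0 _ _ w1 d_lt_beta K_le _ q q_gt0 _ lambda_min Lambda_max B.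
have diag1 j : kernel_mx N w x j j = 1 by exact: kernel_mx_diag.
have eig_near1 (a : R) : eigenvalue (kernel_mx N w x) a%:C -> `|a - 1| <= B.
  case/gershgorin => j; rewrite diag1 -[1]/(1%:C) -rmorphB => near1.
  have := kernel_mx_offdiag_sum_le j d_gt0 N_gt0 d_lt_beta K_le q_gt0.
  move/(le_trans near1); rewrite -lecR; apply: le_trans.
  by rewrite normc_def /= expr0n addr0 sqrtr_sqr.
have /andP[lambda_le1 Lambda_ge1] :=
  extreme_eigenvalues_mean (kernel_mx_hermitian N w x) diag1
    lambda_min Lambda_max.
have := eig_near1 _ lambda_min.1; have := eig_near1 _ Lambda_max.1.
rewrite !ler_norml => /andP[_ Lambda_le] /andP[lambda_ge _].
by split=> //; lra.
Qed.
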